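(* Let $1\le M<N$ and let $\hat\rho_\theta=\sum_{i=1}^M p_i|\psi_i\rangle\langle\psi_i|$ be a smooth family, $\theta\in\mathbb{R}^{N_\theta}$, of rank-$M$ density operators on $\mathbb{C}^N$, where $p_i=p_i(\theta)>0$ for $i=1,\dots,M$ and $|\psi_i\rangle=|\psi_i(\theta)\rangle$ ($i=1,\dots,N$) is an orthonormal basis of $\mathbb{C}^N$, all depending smoothly on $\theta$; put $p_i=0$ for $i=M+1,\dots,N$. Let $f$ be a Petz function with $f(0)>0$. Then the quantum Fisher metric associated with $f$ satisfies, for all $m,n\in\{1,\dots,N_\theta\}$, $$\begin{aligned} g_{\hat\rho_\theta,f}(\partial_m,\partial_n)={}&\sum_{i=1}^M\frac{(\partial_m p_i)(\partial_n p_i)}{p_i}\\ &+\sum_{i,j=1}^M\left(\frac{(p_i-p_j)^2}{p_j f(p_i/p_j)}-\frac{2p_i}{f(0)}\right)\Re\big[\langle\psi_j|\partial_m\psi_i\rangle\langle\partial_n\psi_i|\psi_j\rangle\big]\\ &+\sum_{i=1}^M\frac{2p_i}{f(0)}\,\Re\big[\langle\partial_n\psi_i|\partial_m\psi_i\rangle\big].\end{aligned}$$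
   Context: A Petz function is a function $f:\mathbb{R}_{\ge 0}\to\mathbb{R}_{\ge 0}$ with $f(1)=1$ and $f(t)=t\,f(t^{-1})$ for all $t>0$; it is moreover assumed that $f(t)>0$ for $t>0$ and $f(0)=\lim_{t\to0+}f(t)$. Notation: $\partial_m=\partial/\partial\theta^m$, $|\partial_m\psi_i\rangle=\partial_m|\psi_i\rangle$, and $\langle\partial_m\psi_i|$ is the corresponding bra. The quantum Fisher metric associated with $f$ is $$g_{\hat\rho_\theta,f}(\partial_m,\partial_n)=\sum_{i,j}\frac{1}{p_j f(p_i/p_j)}\langle\psi_j|(\partial_m\hat\rho_\theta)|\psi_i\rangle\langle\psi_i|(\partial_n\hat\rho_\theta)|\psi_j\rangle ,$$ where the sum is over all $i,j\in\{1,\dots,N\}$ with $p_i,p_j$ not both zero (for $i,j>M$ the matrix elements of $\partial_m\hat\rho_\theta$ vanish and these terms are omitted), and where for $p_j=0<p_i$ one uses the convention $$0\cdot f(p_i/0):=\lim_{q\to0+}q\,f(p_i/q)=p_i f(0),$$ while for $p_i=0<p_j$ the denominator is $p_j f(0)$. *)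

(* Defs.v *)
From HB Require Import structures.
From mathcomp Require Import all_boot all_order all_algebra.
From mathcomp Require Import all_classical all_reals all_analysis.
From mathcomp Require Import complex.

Set Implicit Arguments.
Unset Strict Implicit.
Unset Printing Implicit Defensive.

Import Order.TTheory GRing.Theory Num.Theory.
Import numFieldNormedType.Exports.

Local Open Scope classical_set_scope.
Local Open Scope ring_scope.
Local Open Scope sesquilinear_scope.
Local Open Scope complex_scope.

(* Parameter space R^d is the space of row vectors; d/dtheta^m is the
   directional derivative along the m-th standard basis vector. *)
Definition partial (R : realType) (d : nat) (m : 'I_d)
    (h : 'rV[R]_d -> R) : 'rV[R]_d -> R :=
  fun theta => 'D_(delta_mx 0 m) h theta.

Definition iter_partial (R : realType) (d : nat) (s : seq 'I_d)
    (h : 'rV[R]_d -> R) : 'rV[R]_d -> R :=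
  foldr (@partial R d) h s.

(* C^oo: iterated partial derivatives of every order exist and are continuous. *)
Definition smooth (R : realType) (d : nat) (h : 'rV[R]_d -> R) : Prop :=
  forall s : seq 'I_d,
    continuous (iter_partial s h) /\
    forall (m : 'I_d) (theta : 'rV[R]_d),
      derivable (iter_partial s h) theta (delta_mx 0 m).

(* R[i] carries no canonical normed R-module structure in the library, so
   C = R^2 is used explicitly: smoothness and partial derivatives of complex
   matrix-valued maps are taken on the real and imaginary parts of entries. *)
Definition smooth_mx (R : realType) (d k l : nat)
    (A : 'rV[R]_d -> 'M[R[i]]_(k, l)) : Prop :=
  forall a b, smooth (fun theta => complex.Re (A theta a b)) /\
              smooth (fun theta => complex.Im (A theta a b)).

Definition partial_mx (R : realType) (d k l : nat) (m : 'I_d)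
    (A : 'rV[R]_d -> 'M[R[i]]_(k, l)) : 'rV[R]_d -> 'M[R[i]]_(k, l) :=
  fun theta => \matrix_(a, b)
    (partial m (fun t => complex.Re (A t a b)) theta
     +i* partial m (fun t => complex.Im (A t a b)) theta).

(* <u|v>, antilinear in the first argument *)
Definition braket (R : realType) (N : nat) (u v : 'cV[R[i]]_N) : R[i] :=
  (u ^t* *m v) 0 0.

(* |u><u| *)
Definition ketbra (R : realType) (N : nat) (u : 'cV[R[i]]_N) : 'M[R[i]]_N :=
  u *m u ^t*.

(* In R[i], 0 <= z means that z is real and nonnegative. *)
Definition density_operator (R : realType) (N : nat) (A : 'M[R[i]]_N) : Prop :=
  [/\ A \is hermsymmx,
      forall v : 'cV[R[i]]_N, 0 <= braket v (A *m v)
    & \tr A = 1].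

(* An orthonormal family of N vectors of C^N is a basis. *)
Definition orthonormal_basis (R : realType) (N : nat)
    (e : 'I_N -> 'cV[R[i]]_N) : Prop :=
  forall i j, braket (e i) (e j) = (i == j)%:R.

(* Functions on R_{>=0} are represented by functions on R, whose values at
   negative arguments are neither constrained nor used. *)
Definition petz_function (R : realType) (f : R -> R) : Prop :=
  [/\ forall t, 0 <= t -> 0 <= f t,
      f 1 = 1,
      forall t, 0 < t -> f t = t * f t^-1,
      forall t, 0 < t -> 0 < f t
    & f t @[t --> 0^'+] --> f 0].

(* y f(x / y), read as lim_{q -> 0+} q f(x / q) when y = 0. *)
Definition petz_denom (R : realType) (f : R -> R) (x y : R) : R :=
  if y == 0 then lim (q * f (x / q) @[q --> 0^'+]) else y * f (x / y).

Definition fisher_metric (R : realType) (d N : nat) (f : R -> R)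
    (rho : 'rV[R]_d -> 'M[R[i]]_N) (p : 'I_N -> 'rV[R]_d -> R)
    (psi : 'I_N -> 'rV[R]_d -> 'cV[R[i]]_N)
    (theta : 'rV[R]_d) (m n : 'I_d) : R[i] :=
  \sum_(i < N) \sum_(j < N | ~~ ((p i theta == 0) && (p j theta == 0)))
    ((petz_denom f (p i theta) (p j theta))^-1)%:C
    * braket (psi j theta) (partial_mx m rho theta *m psi i theta)
    * braket (psi i theta) (partial_mx n rho theta *m psi j theta).

(* Main.v *)
Require Import Defs.
From HB Require Import structures.
From mathcomp Require Import all_boot all_order all_algebra.
From mathcomp Require Import all_classical all_reals all_analysis.
From mathcomp Require Import complex ring.

Import Order.TTheory GRing.Theory Num.Theory.
Import numFieldNormedType.Exports.

Local Open Scope ring_scope.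
Local Open Scope complex_scope.

(** Differentiating [rho psi_i = p_i psi_i] and pairing with [psi_j] gives
    [<psi_j|d rho|psi_i> = delta_ij d p_i + (p_i - p_j) <psi_j|d psi_i>], where
    [<psi_j|d psi_i>] is antihermitian by orthonormality.  So the metric is the
    classical term plus [sum_ij w_ij z_ij], with
    [z_ij = <psi_j|d_m psi_i><d_n psi_i|psi_j>] hermitian and
    [w_ij = (p_i - p_j)^2 / (p_j f(p_i/p_j))] symmetric; only real parts survive.
    A pair with [i] in the support and [j] in the kernel has [w_ij = p_i / f(0)],
    and Parseval's identity turns the sum over such [j] into
    [<d_n psi_i|d_m psi_i>] minus a sum over the support. *)

(* A complex function is differentiated through its real and imaginary parts,
   as in [partial_mx]. *)
Definition cderive_at {R : realType} {d : nat} (m : 'I_d) (theta : 'rV[R]_d)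
    (g : 'rV[R]_d -> R[i]) (dg : R[i]) : Prop :=
  is_derive theta (delta_mx 0 m : 'rV[R]_d)
    (fun t => complex.Re (g t)) (complex.Re dg) /\
  is_derive theta (delta_mx 0 m : 'rV[R]_d)
    (fun t => complex.Im (g t)) (complex.Im dg).

(** A relation bundling existence and value of the derivative, so that two computations of the same
    derivative can be equated by [mxderive_at_unique]. *)
Definition mxderive_at {R : realType} {d k l : nat} (m : 'I_d)
    (theta : 'rV[R]_d) (A : 'rV[R]_d -> 'M[R[i]]_(k, l))
    (dA : 'M[R[i]]_(k, l)) : Prop :=
  forall a b, cderive_at m theta (fun t => A t a b) (dA a b).

(** * Product rule and adjoints for complex and matrix-valued maps *)

Section Derivation.
Context {R : realType} {d : nat} {m : 'I_d} {theta : 'rV[R]_d}.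
Implicit Types g h : 'rV[R]_d -> R[i].

Lemma complex_ReD (x y : R[i]) :
  complex.Re (x + y) = complex.Re x + complex.Re y.
Proof. by case: x y => ? ? [? ?]. Qed.

Lemma complex_ImD (x y : R[i]) :
  complex.Im (x + y) = complex.Im x + complex.Im y.
Proof. by case: x y => ? ? [? ?]. Qed.

Lemma complex_ReM (x y : R[i]) : complex.Re (x * y) =
  complex.Re x * complex.Re y - complex.Im x * complex.Im y.
Proof. by case: x y => ? ? [? ?]. Qed.

Lemma complex_ImM (x y : R[i]) : complex.Im (x * y) =
  complex.Re x * complex.Im y + complex.Im x * complex.Re y.
Proof. by case: x y => ? ? [? ?]. Qed.

Lemma complex_ReJ (x : R[i]) : complex.Re (Num.conj x) = complex.Re x.
Proof. by case: x. Qed.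

Lemma complex_ImJ (x : R[i]) : complex.Im (Num.conj x) = - complex.Im x.
Proof. by case: x. Qed.

Lemma cderive_at_cst (c : R[i]) : cderive_at m theta (fun=> c) 0.
Proof. by split; apply: is_derive_cst. Qed.

Lemma cderive_at_add {g h dg dh} :
  cderive_at m theta g dg -> cderive_at m theta h dh ->
  cderive_at m theta (fun t => g t + h t) (dg + dh).
Proof.
move=> [gr gi] [hr hi]; split.
- rewrite complex_ReD; under eq_fun do rewrite complex_ReD.
  exact: is_deriveD.
- rewrite complex_ImD; under eq_fun do rewrite complex_ImD.
  exact: is_deriveD.
Qed.

Lemma cderive_at_mul {g h dg dh} :
  cderive_at m theta g dg -> cderive_at m theta h dh ->
  cderive_at m theta (fun t => g t * h t) (dg * h theta + g theta * dh).
Proof.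
move=> [gr gi] [hr hi]; split.
- have -> : (fun t => complex.Re (g t * h t)) =
    (fun t => complex.Re (g t)) * (fun t => complex.Re (h t))
    - (fun t => complex.Im (g t)) * (fun t => complex.Im (h t)).
    by apply/funext => t /=; rewrite complex_ReM.
  apply: is_derive_eq.
  by rewrite complex_ReD !complex_ReM /GRing.scale /=; ring.
- have -> : (fun t => complex.Im (g t * h t)) =
    (fun t => complex.Re (g t)) * (fun t => complex.Im (h t))
    + (fun t => complex.Im (g t)) * (fun t => complex.Re (h t)).
    by apply/funext => t /=; rewrite complex_ImM.
  apply: is_derive_eq.
  by rewrite complex_ImD !complex_ImM /GRing.scale /=; ring.
Qed.

Lemma cderive_at_sum {I : Type} {r : seq I} {g : I -> 'rV[R]_d -> R[i]}
    {dg : I -> R[i]} :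
  (forall k, cderive_at m theta (g k) (dg k)) ->
  cderive_at m theta (fun t => \sum_(k <- r) g k t) (\sum_(k <- r) dg k).
Proof.
move=> gP; elim: r => [|k r IHr].
  rewrite big_nil; under eq_fun do rewrite big_nil.
  exact: cderive_at_cst.
rewrite big_cons; under eq_fun do rewrite big_cons.
exact: cderive_at_add.
Qed.

Lemma cderive_at_conj {g dg} :
  cderive_at m theta g dg ->
  cderive_at m theta (fun t => Num.conj (g t)) (Num.conj dg).
Proof.
move=> [gr gi]; split.
- by rewrite complex_ReJ; under eq_fun do rewrite complex_ReJ.
- rewrite complex_ImJ; under eq_fun do rewrite complex_ImJ.
  exact: is_deriveN.
Qed.

Lemma cderive_at_real {h : 'rV[R]_d -> R} :
  smooth h -> cderive_at m theta (fun t => (h t)%:C) (partial m h theta)%:C.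
Proof.
move=> /(_ [::]) [_ /(_ m theta) h_derivable]; split.
- exact: derivableP.
- exact: is_derive_cst.
Qed.

Lemma mxderive_at_mul {k l q : nat} {A : 'rV[R]_d -> 'M[R[i]]_(k, l)}
    {B : 'rV[R]_d -> 'M[R[i]]_(l, q)} {dA dB} :
  mxderive_at m theta A dA -> mxderive_at m theta B dB ->
  mxderive_at m theta (fun t => A t *m B t) (dA *m B theta + A theta *m dB).
Proof.
move=> AP BP a b.
rewrite !mxE -big_split /=; under eq_fun do rewrite mxE.
by apply: cderive_at_sum => c; apply: cderive_at_mul.
Qed.

Lemma mxderive_at_scale {k l : nat} {h : 'rV[R]_d -> R[i]}
    {A : 'rV[R]_d -> 'M[R[i]]_(k, l)} {dh dA} :
  cderive_at m theta h dh -> mxderive_at m theta A dA ->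
  mxderive_at m theta (fun t => h t *: A t) (dh *: A theta + h theta *: dA).
Proof.
move=> hP AP a b; rewrite !mxE; under eq_fun do rewrite mxE.
exact: cderive_at_mul.
Qed.

Lemma mxderive_at_adj {k l : nat} {A : 'rV[R]_d -> 'M[R[i]]_(k, l)} {dA} :
  mxderive_at m theta A dA ->
  mxderive_at m theta (fun t => (A t)^t*%sesqui) (dA^t*)%sesqui.
Proof.
move=> AP a b; rewrite !mxE; under eq_fun do rewrite !mxE.
exact: cderive_at_conj.
Qed.

Lemma mxderive_at_partial {k l : nat} {A : 'rV[R]_d -> 'M[R[i]]_(k, l)} :
  smooth_mx A -> mxderive_at m theta A (partial_mx m A theta).
Proof.
move=> A_smooth a b; have [Ar Ai] := A_smooth a b; split; rewrite mxE /=.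
- by have [_ /(_ m theta)] := Ar [::]; exact: derivableP.
- by have [_ /(_ m theta)] := Ai [::]; exact: derivableP.
Qed.

Lemma mxderive_at_unique {k l : nat} {A : 'rV[R]_d -> 'M[R[i]]_(k, l)} {dA dB} :
  mxderive_at m theta A dA -> mxderive_at m theta A dB -> dA = dB.
Proof.
move=> AP BP; apply/matrixP => a b.
have [[? Ar] [? Ai]] := AP a b; have [[? Br] [? Bi]] := BP a b.
by apply/eqP; rewrite eq_complex -Ar -Ai -Br -Bi !eqxx.
Qed.

End Derivation.

(** * Inner products and orthonormal bases *)

Section Braket.
Context {R : realType} {N : nat}.
Implicit Types u v w : 'cV[R[i]]_N.

Lemma braket_conj u v : braket v u = Num.conj (braket u v).
Proof.
rewrite /braket !mxE rmorph_sum /=; apply: eq_bigr => k _.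
by rewrite !mxE rmorphM /= conjCK mulrC.
Qed.

Lemma braketDr u v w : braket u (v + w) = braket u v + braket u w.
Proof. by rewrite /braket mulmxDr mxE. Qed.

Lemma braketZr u v (c : R[i]) : braket u (c *: v) = c * braket u v.
Proof. by rewrite /braket -scalemxAr mxE. Qed.

Lemma braket_sumr u (I : Type) (r : seq I) (P : pred I)
    (v : I -> 'cV[R[i]]_N) :
  braket u (\sum_(i <- r | P i) v i) = \sum_(i <- r | P i) braket u (v i).
Proof. by rewrite /braket mulmx_sumr summxE. Qed.

Lemma ketbra_mul u v : ketbra u *m v = braket u v *: u.
Proof.
by rewrite /ketbra -mulmxA [X in u *m X]mx11_scalar mul_mx_scalar.
Qed.

(** The matrix [U] with columns [e j] has [U^t*] as left inverse; being square, it also has it as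
    right inverse, which is the completeness relation. *)
Lemma parseval {e : 'I_N -> 'cV[R[i]]_N} u v : orthonormal_basis e ->
  braket u v = \sum_j braket u (e j) * braket (e j) v.
Proof.
move=> e_onb.
pose U : 'M[R[i]]_N := \matrix_(a, j) e j a 0.
have UU : (U^t* *m U = 1%:M)%sesqui.
  apply/matrixP => i j; rewrite !mxE -e_onb /braket mxE.
  by apply: eq_bigr => k _; rewrite !mxE.
have -> : braket u v = ((u^t* *m U) *m (U^t* *m v))%sesqui 0 0.
  by rewrite mulmxA -(mulmxA _ U) (mulmx1C UU) mulmx1.
rewrite mxE; apply: eq_bigr => j _; congr (_ * _).
- by rewrite /braket !mxE; apply: eq_bigr => k _; rewrite !mxE.
- by rewrite /braket !mxE; apply: eq_bigr => k _; rewrite !mxE.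
Qed.

End Braket.

(** * Petz denominators and their boundary values *)

Section Petz.
Context {R : realType} {f : R -> R}.
Hypothesis f_petz : petz_function f.

(** This symmetry is the functional equation of [f] at [t = x / y]. *)
Lemma petz_denomC {x y} : 0 < x -> 0 < y -> petz_denom f x y = petz_denom f y x.
Proof.
have [_ _ f_inv _ _] := f_petz.
move=> x0 y0; rewrite /petz_denom !gt_eqF // f_inv ?divr_gt0 // invf_div.
by rewrite mulrA mulrCA divff ?mulr1 // gt_eqF.
Qed.

Lemma petz_denom_diag {x} : 0 < x -> petz_denom f x x = x.
Proof.
have [_ f1 _ _ _] := f_petz.
by move=> x0; rewrite /petz_denom gt_eqF // divff ?gt_eqF // f1 mulr1.
Qed.

Lemma petz_denom0l {y} : 0 < y -> petz_denom f 0 y = y * f 0.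
Proof. by move=> y0; rewrite /petz_denom gt_eqF // mul0r. Qed.

(** The functional equation turns [q * f (x / q)] into [x * f (q / x)], and [f] is right-continuous
    at 0. *)
Lemma petz_denom0r {x} : 0 < x -> petz_denom f x 0 = x * f 0.
Proof.
have [_ _ f_inv _ f_cvg] := f_petz.
move=> x0; rewrite /petz_denom eqxx; apply/cvg_lim => //.
have f_scaled : (x * f (q / x) @[q --> 0^'+] --> x * f 0)%classic.
  apply: cvgM; first exact: cvg_cst.
  (* Right limits are tested on sequences: if [u n] is positive and tends to 0, so is and does
     [u n / x]. *)
  apply/cvg_at_rightP => u [u0 u_cvg].
  apply: (cvg_at_rightP f 0 (f 0)).1 f_cvg (fun n => u n / x) _; split.
    by move=> n; rewrite divr_gt0.
  rewrite -[X in (_ --> X)%classic](mul0r x^-1); apply: cvgM => //.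
  exact: cvg_cst.
apply: cvg_trans f_scaled; apply: near_eq_cvg.
near=> q.
have q0 : 0 < q by near: q; exact: nbhs_right_gt.
rewrite [f (x / q)]f_inv ?divr_gt0 // invf_div.
by rewrite mulrA mulrCA divff ?mulr1 // gt_eqF.
Unshelve. all: by end_near.
Qed.

End Petz.

(** * Double sums with symmetric weights *)

Section WeightedSums.
Context {R : realType} {I : finType}.

(** Exchanging the two indices conjugates each term, so the total is its own conjugate. *)
Lemma hermitian_weighted_sum {w : I -> I -> R} {z : I -> I -> R[i]} :
  (forall i j, w j i = w i j) -> (forall i j, z j i = Num.conj (z i j)) ->
  \sum_i \sum_j (w i j)%:C * z i j =
  (\sum_i \sum_j w i j * complex.Re (z i j))%:C.
Proof.
move=> w_sym z_herm.
set S := \sum_i _.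
have S_real : Num.conj S = S.
  rewrite /S rmorph_sum /= exchange_big /=; apply: eq_bigr => i _.
  rewrite rmorph_sum /=; apply: eq_bigr => j _.
  by rewrite rmorphM /= -z_herm w_sym; congr (_ * _); apply: conjc_real.
have ReE : complex.Re S = \sum_i \sum_j w i j * complex.Re (z i j).
  rewrite /S (big_morph _ complex_ReD (erefl : complex.Re (0 : R[i]) = 0)).
  apply: eq_bigr => i _.
  rewrite (big_morph _ complex_ReD (erefl : complex.Re (0 : R[i]) = 0)).
  by apply: eq_bigr => j _; rewrite complex_ReM mul0r subr0.
rewrite -ReE; apply/eqP; rewrite eq_complex /= eqxx /=.
(* Since [S] equals its conjugate, its imaginary part is its own opposite, so twice it is 0. *)
have /eqP := complex_ImJ S; rewrite S_real -addr_eq0 -mulr2n mulrn_eq0 /=.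
by [].
Qed.

(** By symmetry the two mixed blocks, [P] against its complement, are equal: hence the factor 2.
    Writing a sum over the complement as the full sum minus the sum over [P] gives the correction
    [- 2 * c i]. *)
Lemma sum_weight_split {P : pred I} {w r : I -> I -> R} {c : I -> R} :
  (forall i j, w j i = w i j) -> (forall i j, r j i = r i j) ->
  (forall i j, P i -> ~~ P j -> w i j = c i) ->
  (forall i j, ~~ P i -> ~~ P j -> w i j = 0) ->
  \sum_i \sum_j w i j * r i j =
  \sum_(i | P i) \sum_(j | P j) (w i j - 2 * c i) * r i j
  + \sum_(i | P i) 2 * c i * \sum_j r i j.
Proof.
move=> w_sym r_sym wc w0.
(* Rows outside [P] only meet columns in [P]; swapping the indices makes them a second copy of the
   mixed block. *)
have mixed : \sum_(i | ~~ P i) \sum_j w i j * r i j =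
    \sum_(i | P i) \sum_(j | ~~ P j) c i * r i j.
  rewrite [RHS]exchange_big /=.
  apply: eq_bigr => j Pj; rewrite (bigID P) /= [X in _ + X]big1 ?addr0.
    by apply: eq_bigr => i Pi; rewrite w_sym r_sym wc.
  by move=> i Pi; rewrite w0 // mul0r.
rewrite (bigID P) /= mixed -!big_split /=; apply: eq_bigr => i Pi.
have -> : \sum_j w i j * r i j =
    \sum_(j | P j) w i j * r i j + c i * \sum_(j | ~~ P j) r i j.
  rewrite (bigID P) /= mulr_sumr; congr (_ + _).
  by apply: eq_bigr => j Pj; rewrite wc.
have -> : \sum_(j | P j) (w i j - 2 * c i) * r i j =
    \sum_(j | P j) w i j * r i j - 2 * c i * \sum_(j | P j) r i j.
  by rewrite mulr_sumr -sumrB; apply: eq_bigr => j _; rewrite mulrBl.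
rewrite -mulr_sumr (bigID P predT) /=.
by ring.
Qed.

End WeightedSums.

(** * Derivatives of the eigenvectors and of the density operator *)

Section SpectralDerivatives.
Context {R : realType} {d N : nat}.
Context {psi : 'I_N -> 'rV[R]_d -> 'cV[R[i]]_N}.
Hypothesis psi_smooth : forall i, smooth_mx (psi i).
Hypothesis psi_onb : forall t, orthonormal_basis (fun i => psi i t).

(** By orthonormality [braket (psi i t) (psi j t)] is constant in [t], so the two terms of its
    product rule cancel. *)
Lemma onb_connection_antiherm (m : 'I_d) theta i j :
  braket (psi i theta) (partial_mx m (psi j) theta) =
  - Num.conj (braket (psi j theta) (partial_mx m (psi i) theta)).
Proof.
have D k := mxderive_at_partial (m := m) (theta := theta) (psi_smooth k).
have := mxderive_at_mul (mxderive_at_adj (D i)) (D j).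
rewrite (_ : (fun t => _) = fun=> (i == j)%:R%:M); last first.
  by apply/funext => t; rewrite [LHS]mx11_scalar -(psi_onb t i j).
move=> D1.
have D0 : mxderive_at m theta (fun=> (i == j)%:R%:M : 'M[R[i]]_1) 0.
  by move=> a b; rewrite !mxE; apply: cderive_at_cst.
have /matrixP/(_ 0 0) := mxderive_at_unique D1 D0.
rewrite !mxE -braket_conj => /eqP; rewrite addrC addr_eq0 => /eqP.
by rewrite /braket !mxE.
Qed.

Context {p : 'I_N -> 'rV[R]_d -> R} {rho : 'rV[R]_d -> 'M[R[i]]_N}.
Hypothesis p_smooth : forall i, smooth (p i).
Hypothesis rho_smooth : smooth_mx rho.
Hypothesis rho_spectral :
  forall t, rho t = \sum_i (p i t)%:C *: ketbra (psi i t).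

Lemma spectral_eigenvector t i : rho t *m psi i t = (p i t)%:C *: psi i t.
Proof.
rewrite rho_spectral mulmx_suml (bigD1 i) //= big1 ?addr0.
  by rewrite -scalemxAl ketbra_mul psi_onb eqxx scale1r.
move=> k ki; rewrite -scalemxAl ketbra_mul psi_onb (negPf ki).
by rewrite scale0r scaler0.
Qed.

(** The operator acts on the bra, as a self-adjoint one with real eigenvalue [p j t] does. *)
Lemma braket_spectral t j v :
  braket (psi j t) (rho t *m v) = (p j t)%:C * braket (psi j t) v.
Proof.
rewrite rho_spectral mulmx_suml braket_sumr (bigD1 j) //= big1 ?addr0.
  by rewrite -scalemxAl ketbra_mul !braketZr psi_onb eqxx mulr1.
move=> k kj; rewrite -scalemxAl ketbra_mul !braketZr psi_onb eq_sym (negPf kj).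
by rewrite !mulr0.
Qed.

(** After pairing with [psi j], the term where [rho] acts on the derivative of [psi i] carries the
    factor [p j]; moving it across produces [p i - p j]. *)
Lemma braket_partial_spectral (m : 'I_d) theta i j :
  braket (psi j theta) (partial_mx m rho theta *m psi i theta) =
  (partial m (p i) theta)%:C * (j == i)%:R
  + (p i theta - p j theta)%:C
    * braket (psi j theta) (partial_mx m (psi i) theta).
Proof.
have Dpsi := mxderive_at_partial (m := m) (theta := theta) (psi_smooth i).
have D1 := mxderive_at_mul
  (mxderive_at_partial (m := m) (theta := theta) rho_smooth) Dpsi.
have D2 := mxderive_at_scale
  (cderive_at_real (m := m) (theta := theta) (p_smooth i)) Dpsi.
have eqf : (fun t => rho t *m psi i t) = (fun t => (p i t)%:C *: psi i t).
  by apply/funext => t; apply: spectral_eigenvector.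
rewrite eqf in D1.
have /(congr1 (braket (psi j theta))) := mxderive_at_unique D1 D2.
rewrite !braketDr !braketZr braket_spectral psi_onb => /(canRL (addrK _)) ->.
by rewrite rmorphB /= mulrBl addrA.
Qed.

End SpectralDerivatives.

Theorem mainTheorem3 (R : realType) (d M N : nat)
  (hM : (1 <= M)%N) (hMN : (M < N)%N)
  (rho : 'rV[R]_d -> 'M[R[i]]_N)
  (p : 'I_N -> 'rV[R]_d -> R)
  (psi : 'I_N -> 'rV[R]_d -> 'cV[R[i]]_N)
  (rho_smooth : smooth_mx rho)
  (rho_density : forall theta, density_operator (rho theta))
  (rho_rank : forall theta, \rank (rho theta) = M)
  (p_smooth : forall i, smooth (p i))
  (p_pos : forall (i : 'I_N) theta, (i < M)%N -> 0 < p i theta)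
  (p_zero : forall (i : 'I_N) theta, (M <= i)%N -> p i theta = 0)
  (psi_smooth : forall i, smooth_mx (psi i))
  (psi_onb : forall theta, orthonormal_basis (fun i => psi i theta))
  (rho_def : forall theta,
     rho theta = \sum_(i < N | (i < M)%N) (p i theta)%:C *: ketbra (psi i theta))
  (f : R -> R) (hf : petz_function f) (hf0 : 0 < f 0)
  (theta : 'rV[R]_d) (m n : 'I_d) :
  fisher_metric f rho p psi theta m n =
  (\sum_(i < N | (i < M)%N)
      (partial m (p i) theta * partial n (p i) theta) / p i theta
   + \sum_(i < N | (i < M)%N) \sum_(j < N | (j < M)%N)
      ((p i theta - p j theta) ^+ 2 / (p j theta * f (p i theta / p j theta))
         - 2 * p i theta / f 0)
      * complex.Re (braket (psi j theta) (partial_mx m (psi i) theta)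
                    * braket (partial_mx n (psi i) theta) (psi j theta))
   + \sum_(i < N | (i < M)%N)
      2 * p i theta / f 0
      * complex.Re (braket (partial_mx n (psi i) theta)
                           (partial_mx m (psi i) theta)))%:C.
Proof.
(* The eigenvalues from index [M] on vanish, so the sum extends to the whole basis. *)
have rho_spectral t : rho t = \sum_i (p i t)%:C *: ketbra (psi i t).
  rewrite rho_def big_mkcond /=; apply: eq_bigr => i _.
  by case: ltnP => // Mi; rewrite p_zero // scale0r.
pose q i := p i theta.
have q0 (i : 'I_N) : (q i == 0) = ~~ (i < M)%N.
  by case: ltnP => Mi; [rewrite gt_eqF ?p_pos | rewrite /q p_zero ?eqxx].
have q_pos (i : 'I_N) : (i < M)%N -> 0 < q i by exact: p_pos.
have q_zero (i : 'I_N) : ~~ (i < M)%N -> q i = 0.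
  by rewrite -q0 => /eqP.
pose a k i j := braket (psi j theta) (partial_mx k (psi i) theta).
pose z i j := a m i j * Num.conj (a n i j).
(* Kernel pairs get weight 0, matching the terms omitted from [fisher_metric]. *)
pose w i j := if (q i == 0) && (q j == 0) then 0
  else (q i - q j) ^+ 2 / petz_denom f (q i) (q j).
have z_herm i j : z j i = Num.conj (z i j).
  rewrite /z /a !(onb_connection_antiherm psi_smooth psi_onb _ _ i j).
  by rewrite rmorphN rmorphM /= !conjCK mulrNN.
have w_sym i j : w j i = w i j.
  rewrite /w andbC; case: ifPn => // q_ij.
  rewrite -sqrrN opprB; congr (_ / _).
  (* On mixed pairs both orders give the positive eigenvalue times [f 0], one by direct evaluation
     and the other by the limit convention. *)
  have [Mi|Mi] := boolP (i < M)%N; have [Mj|Mj] := boolP (j < M)%N.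
  - by rewrite (petz_denomC hf) ?q_pos.
  - by rewrite (q_zero j) // petz_denom0l ?(petz_denom0r hf) ?q_pos.
  - by rewrite (q_zero i) // petz_denom0l ?(petz_denom0r hf) ?q_pos.
  - by move: q_ij; rewrite !q0 Mi Mj.
have wc (i j : 'I_N) : (i < M)%N -> ~~ (j < M)%N -> w i j = q i / f 0.
  move=> Mi Mj; rewrite /w !q0 Mi Mj /= (q_zero j Mj) subr0.
  rewrite (petz_denom0r hf) ?q_pos // expr2 -mulf_div divff ?mul1r //.
  by rewrite q0 Mi.
have w0 (i j : 'I_N) : ~~ (i < M)%N -> ~~ (j < M)%N -> w i j = 0.
  by move=> Mi Mj; rewrite /w !q0 Mi Mj.
have zE i j : z i j = braket (psi j theta) (partial_mx m (psi i) theta)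
    * braket (partial_mx n (psi i) theta) (psi j theta).
  by rewrite /z -braket_conj.
have fisherE : fisher_metric f rho p psi theta m n =
    \sum_(i < N | (i < M)%N)
      (partial m (p i) theta * partial n (p i) theta / p i theta)%:C
    + \sum_i \sum_j (w i j)%:C * z i j.
  rewrite /fisher_metric [X in X + _]big_mkcond -big_split /=.
  apply: eq_bigr => i _; rewrite big_mkcond /=.
  (* The classical term is placed at [j = i] of an inner sum, so that both sides compare term by
     term. *)
  rewrite [X in X + _](_ : _ = \sum_j (if j == i then
    (if (i < M)%N then
      (partial m (p i) theta * partial n (p i) theta / p i theta)%:C
     else 0) else 0)); last by rewrite -big_mkcond big_pred1_eq.
  rewrite -big_split /=; apply: eq_bigr => j _.
  rewrite !(braket_partial_spectral psi_smooth psi_onb p_smooth rho_smooth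
    rho_spectral) (onb_connection_antiherm psi_smooth psi_onb n theta i j).
  rewrite -/(q i) -/(q j) -/(a m i j) -/(a n i j) /w /z.
  have [q_ij|q_ij] := boolP ((q i == 0) && (q j == 0)).
    by move: q_ij; rewrite q0 => /andP[/negPf -> _]; rewrite if_same mul0r addr0.
  (* On the diagonal [q i - q j] kills the connection terms and the denominator is [q i]. *)
  have [ji|ji] := eqVneq j i.
    rewrite {j}ji in q_ij *; move: q_ij; rewrite andbb q0 negbK => Mi.
    rewrite Mi !subrr expr0n /= mul0r !mul0r !addr0 !mulr1.
    rewrite (petz_denom_diag hf) ?q_pos // -!rmorphM /=.
    by congr (_%:C); rewrite -mulrA mulrC.
  (* Off the diagonal the Kronecker terms vanish, and the sign of [q j - q i] cancels the one from
     antihermiticity, leaving a square. *)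
  rewrite /= !mulr0 !add0r -[q j - q i]opprB rmorphN /= mulrNN rmorphM /= rmorphXn.
  by rewrite /=; ring.
rewrite fisherE (hermitian_weighted_sum w_sym z_herm).
rewrite (sum_weight_split w_sym _ wc w0); last first.
  by move=> i j; rewrite z_herm complex_ReJ.
rewrite -rmorph_sum -rmorphD /= addrA; congr ((_ + _ + _)%:C).
- apply: eq_bigr => i Mi; apply: eq_bigr => j Mj.
  rewrite zE; congr ((_ - _) * _); last by rewrite mulrA.
  by rewrite /w q0 Mi /= /petz_denom q0 Mj.
- apply: eq_bigr => i Mi; rewrite mulrA; congr (_ * _).
  (* The sum over [j] runs over the full basis, kernel included, so it collapses to one inner
     product. *)
  rewrite (parseval (partial_mx n (psi i) theta) _ (psi_onb theta)).
  rewrite (big_morph _ complex_ReD (erefl : complex.Re (0 : R[i]) = 0)).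
  by apply: eq_bigr => j _; rewrite zE mulrC.
Qed.
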